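(* For any integers $m, k \ge 1$, $$\sum_{I \in J (P_{k, mk + 1})} \left( \sigma(I) - \binom{|I|}{2} \right) = \frac{mk (k - 1) ((m + 1)k + 2)}{24 (mk + 1)} \binom{(m + 1)k}{k}.$$
   Context: For coprime positive integers $a, b$, $P_{a,b}$ denotes the (finite) poset whose elements are all positive integers not contained in the numerical semigroup generated by $\{a,b\}$ (i.e. not of the form $ua+vb$ with integers $u,v\ge 0$), with the partial order determined by requiring that $p$ covers $q$ whenever $p - q \in \{a, b\}$. For a poset $P$, $J(P)$ is the set of order ideals (down-closed subsets, including the empty one) of $P$. For a finite set $I$ of integers, $\sigma(I) = \sum_{i \in I} i$. *)

(* Defs.v *)
From HB Require Import structures.
From mathcomp Require Import all_boot all_order all_algebra.

Set Implicit Arguments.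
Unset Strict Implicit.
Unset Printing Implicit Defensive.

(* The coefficients of n = u * a + v * b are at most n when a, b > 0, so the
   search can be bounded: see in_semigroupP. *)
Definition in_semigroup (a b n : nat) : bool :=
  [exists u : 'I_n.+1, exists v : 'I_n.+1, n == u * a + v * b].

Lemma in_semigroupP a b n : 0 < a -> 0 < b ->
  reflect (exists u v : nat, n = u * a + v * b) (in_semigroup a b n).
Proof.
move=> a0 b0; apply: (iffP existsP) => [[u /existsP[v /eqP e]]|[u [v e]]].
  by exists u, v.
have hu : u < n.+1 by rewrite ltnS e (leq_trans (leq_pmulr u a0)) ?leq_addr.
have hv : v < n.+1 by rewrite ltnS e (leq_trans (leq_pmulr v b0)) ?leq_addl.
by exists (Ordinal hu); apply/existsP; exists (Ordinal hv); apply/eqP.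
Qed.

Definition gap (a b n : nat) : bool := (0 < n) && ~~ in_semigroup a b n.

Lemma gap_ltn a b n : 0 < a -> 0 < b -> coprime a b -> gap a b n -> n < a * b.
Proof.
move=> a0 b0 cab /andP[_]; rewrite ltnNge; apply: contra => le_ab_n.
apply/in_semigroupP => //; pose y := chinese a b n 0 %% (a * b).
have y_n : y <= n by rewrite (leq_trans (ltnW (ltn_pmod _ _))) ?muln_gt0 ?a0.
have ya : y = n %[mod a].
  by rewrite /y modn_dvdm ?dvdn_mulr // chinese_modl.
have /dvdnP[v yv] : b %| y.
  by rewrite /dvdn /y modn_dvdm ?dvdn_mull // chinese_modr // mod0n.
have /dvdnP[u yu] : a %| n - y by rewrite -eqn_mod_dvd // ya.
by exists u, v; rewrite -yu -yv subnK.
Qed.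

(* P_{a,b}.  Carving the gaps out of 'I_(a * b) loses none of them when a and b
   are coprime: see gap_posetP. *)
Record gap_poset (a b : nat) : Type :=
  GapPoset { gap_ord : 'I_(a * b); _ : gap a b gap_ord }.

HB.instance Definition _ (a b : nat) := [isSub for @gap_ord a b].
HB.instance Definition _ (a b : nat) := [Finite of gap_poset a b by <:].

Definition gap_val (a b : nat) (x : gap_poset a b) : nat := gap_ord x.

Lemma gap_posetP a b n : 0 < a -> 0 < b -> coprime a b ->
  gap a b n <-> exists x : gap_poset a b, gap_val x = n.
Proof.
move=> a0 b0 cab; split=> [gn|[[x gx] <-]//].
by exists (@GapPoset a b (Ordinal (gap_ltn a0 b0 cab gn)) gn).
Qed.

Definition gap_cover (a b : nat) : rel (gap_poset a b) :=
  fun q p => (gap_val p == gap_val q + a) || (gap_val p == gap_val q + b).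

Definition gap_le (a b : nat) : rel (gap_poset a b) := connect (@gap_cover a b).

Lemma gap_le_leq a b (q p : gap_poset a b) :
  gap_le q p -> gap_val q <= gap_val p.
Proof.
case/connectP=> s; elim: s q => [q _ -> //|x s IHs q /= /andP[qx xs] def_p].
apply: leq_trans (IHs x xs def_p).
by case/orP: qx => /eqP->; apply: leq_addr.
Qed.

Fact gap_le_refl a b : reflexive (@gap_le a b).
Proof. exact: connect0. Qed.

Fact gap_le_anti a b : antisymmetric (@gap_le a b).
Proof.
move=> x y /andP[/gap_le_leq xy /gap_le_leq yx].
by do 2! apply: val_inj; apply/eqP; rewrite eqn_leq [_ <= _]xy.
Qed.

Fact gap_le_trans a b : transitive (@gap_le a b).
Proof. exact: connect_trans. Qed.

Fact gap_display : Order.disp_t. Proof. exact: (Order.Disp tt tt). Qed.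

HB.instance Definition _ (a b : nat) :=
  Order.Le_isPOrder.Build gap_display (gap_poset a b)
    (@gap_le_refl a b) (@gap_le_anti a b) (@gap_le_trans a b).

Definition order_ideals (d : Order.disp_t) (P : finPOrderType d) : {set {set P}} :=
  [set I : {set P} | [forall x in I, forall y : P, (y <= x)%O ==> (y \in I)]].

Definition sigma (a b : nat) (I : {set gap_poset a b}) : nat :=
  \sum_(x in I) gap_val x.

(* Main.v *)
(* Put K = n + 1 = k and N = m k + 1.  An order ideal I is determined by its
   runners c_r = #{x in I : x = r mod K}, and z_r = c_r + m - c_(r+1), with an
   extra 1 at r = n, is a weak composition of N into K parts all of whose
   heights h_r = r N - K (z_0 + ... + z_(r-1)) = r + K c_r are nonnegative.
   In these terms sigma(I) - binom(|I|, 2) is, up to a constant, the variance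
   of the heights, which does not change when z is rotated cyclically.  As K
   and N are coprime, exactly one rotation of each weak composition has
   nonnegative heights, so the sum over ideals is 1/K times the sum of the same
   quadratic function over all weak compositions, where only the second moments
   of the parts matter. *)
Require Import Defs.
From HB Require Import structures.
From mathcomp Require Import all_boot all_order all_algebra.
From mathcomp Require Import fingroup perm zify ring.

Import GRing.Theory Num.Theory Order.TTheory.
Local Open Scope ring_scope.

Set Implicit Arguments.
Unset Strict Implicit.
Unset Printing Implicit Defensive.

(** * Weak compositions, their heights and cyclic rotations *)

(* The bound N on the parts is independent of the total b, so that the moments
   can be computed by induction on b inside a single type. *)
Definition wcomp (n N b : nat) : {set {ffun 'I_n.+1 -> 'I_N.+1}} :=
  [set z : {ffun 'I_n.+1 -> 'I_N.+1} | (\sum_i z i)%N == b].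

Definition psum (n N : nat) (z : {ffun 'I_n.+1 -> 'I_N.+1}) (r : nat) : nat :=
  \sum_(j < n.+1 | (j < r)%N) z j.

(** Rational-valued: heights of a general composition can be negative, and their moments have
    denominators. *)
Definition height (n N : nat) (z : {ffun 'I_n.+1 -> 'I_N.+1}) (r : nat) : rat :=
  (r * N)%:R - (n.+1 * psum z r)%:R.

Definition rot_comp (n N : nat) (s : 'I_n.+1) (z : {ffun 'I_n.+1 -> 'I_N.+1}) :
  {ffun 'I_n.+1 -> 'I_N.+1} := [ffun i => z (i + s)].

Lemma psum0 n N (z : {ffun 'I_n.+1 -> 'I_N.+1}) : psum z 0 = 0%N.
Proof. by rewrite /psum big_pred0. Qed.

Lemma psumS n N (z : {ffun 'I_n.+1 -> 'I_N.+1}) (r : 'I_n.+1) :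
  psum z r.+1 = (psum z r + z r)%N.
Proof.
rewrite /psum (bigD1 r) //= addnC; congr (_ + _)%N.
by apply: eq_bigl => j; rewrite ltnS [RHS]ltn_neqAle andbC.
Qed.

Lemma psum_full n N b (z : {ffun 'I_n.+1 -> 'I_N.+1}) :
  z \in wcomp n N b -> psum z n.+1 = b.
Proof.
rewrite inE => /eqP <-; apply: eq_bigl => j; exact: ltn_ord.
Qed.

Lemma height0 n N (z : {ffun 'I_n.+1 -> 'I_N.+1}) : height z 0 = 0.
Proof. by rewrite /height psum0 mul0n muln0 subrr. Qed.

(** At the last index [ordS] wraps round to 0; the recurrence persists there because the total N
    makes the height at K vanish. *)
Lemma height_ordS n N (z : {ffun 'I_n.+1 -> 'I_N.+1}) (r : 'I_n.+1) :
  z \in wcomp n N N ->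
  height z (ordS r) = height z r + (N%:R - (n.+1 * z r)%:R).
Proof.
move=> zc.
have -> : height z (ordS r) = height z r.+1.
  rewrite /=; have := ltn_ord r; rewrite leq_eqVlt => /orP[/eqP e|h].
    by rewrite e modnn height0 /height (psum_full zc) subrr.
  by rewrite modn_small.
rewrite /height psumS mulSn mulnDr !natrD; ring.
Qed.

Lemma height_unique n N (z : {ffun 'I_n.+1 -> 'I_N.+1}) (g : 'I_n.+1 -> rat) :
  z \in wcomp n N N -> g ord0 = 0 ->
  (forall r, g (ordS r) = g r + (N%:R - (n.+1 * z r)%:R)) ->
  forall r, g r = height z r.
Proof.
move=> zc g0 gS [r hr]; elim: r hr => [|r IH] hr.
  by rewrite /= height0 -g0; congr (g _); apply: val_inj.
have hr' := ltnW hr.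
have -> : Ordinal hr = ordS (Ordinal hr') by apply: val_inj; rewrite /= modn_small.
by rewrite gS IH height_ordS.
Qed.

Lemma rot_comp_wcomp n N b (s : 'I_n.+1) (z : {ffun 'I_n.+1 -> 'I_N.+1}) :
  (rot_comp s z \in wcomp n N b) = (z \in wcomp n N b).
Proof.
rewrite !inE; congr (_ == _).
rewrite [RHS](reindex_inj (addIr s)) /=.
by apply: eq_bigr => i _; rewrite ffunE.
Qed.

Lemma rot_compK n N (s : 'I_n.+1) : cancel (@rot_comp n N s) (rot_comp (- s)).
Proof. by move=> z; apply/ffunP => i; rewrite !ffunE addrNK. Qed.

Lemma ordSD n (r s : 'I_n.+1) : ordS (r + s) = ordS r + s.
Proof.
apply: val_inj; rewrite /= modnDml -[in LHS]addn1 modnDml addn1 addSn //.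
Qed.

(** Both sides vanish at 0 and have the same cyclic increments, so [height_unique] applies. *)
Lemma height_rot n N (s : 'I_n.+1) (z : {ffun 'I_n.+1 -> 'I_N.+1}) (r : 'I_n.+1) :
  z \in wcomp n N N ->
  height (rot_comp s z) r = height z (r + s)%R - height z s.
Proof.
move=> zc; symmetry.
apply: (@height_unique n N _ (fun r => height z (r + s)%R - height z s)).
- by rewrite rot_comp_wcomp.
- by rewrite add0r subrr.
by move=> {}r; rewrite ffunE -ordSD height_ordS // addrAC.
Qed.

(** For r <= s, equal heights force K to divide (s - r) N, hence s - r by coprimality, while s - r <
    K. *)
Lemma height_inj n N (z : {ffun 'I_n.+1 -> 'I_N.+1}) (r s : 'I_n.+1) :
  coprime n.+1 N -> height z r = height z s -> r = s.
Proof.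
move=> cop; wlog le_rs : r s / (r <= s)%N => [W e|].
  by case/orP: (leq_total r s) => h; [apply: W | symmetry; apply: W].
rewrite /height => /eqP; rewrite subr_eq addrAC eq_sym subr_eq -!natrD eqr_nat => /eqP e.
have dvd_rs : (n.+1 %| (s - r) * N)%N.
  apply/dvdnP; exists (psum z s - psum z r)%N; rewrite !mulnBl ![(_ * n.+1)%N]mulnC; lia.
move: dvd_rs; rewrite Gauss_dvdl //.
have [/dvdn_leq h /h|] := ltnP 0 (s - r)%N.
  by have := ltn_ord s; lia.
by rewrite leqn0 subn_eq0 => le_sr _; apply/val_inj/eqP; rewrite eqn_leq le_rs.
Qed.

(** * The cycle lemma *)

Definition dyck (n N : nat) (z : {ffun 'I_n.+1 -> 'I_N.+1}) : bool :=
  [forall r : 'I_n.+1, 0 <= height z r].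

(** The rotation by s is Dyck exactly when s minimises the height, and [height_inj] makes the
    minimiser unique. After exchanging the sums, each of the K rotations contributes the same Dyck
    sum. *)
Lemma cycle_lemma n N (f : {ffun 'I_n.+1 -> 'I_N.+1} -> rat) :
  coprime n.+1 N ->
  (forall s z, z \in wcomp n N N -> f (rot_comp s z) = f z) ->
  \sum_(z in wcomp n N N) f z
  = n.+1%:R * \sum_(z in wcomp n N N | dyck z) f z.
Proof.
move=> cop f_rot.
have -> : \sum_(z in wcomp n N N) f z
    = \sum_(z in wcomp n N N) \sum_(s | dyck (rot_comp s z)) f z.
  apply: eq_bigr => z zc.
  have dyckE s : dyck (rot_comp s z) = [forall r : 'I_n.+1, height z s <= height z r].
    apply/forallP/forallP => h r.
      by have := h (r - s); rewrite height_rot // subrK subr_ge0.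
    by rewrite height_rot // subr_ge0.
  have [s _ s_min] := @arg_minP _ _ _ ord0 predT (fun r : 'I_n.+1 => height z r) isT.
  rewrite (big_pred1 s) // => t; rewrite dyckE; apply/forallP/eqP => [h|-> r];
    last exact: s_min.
  apply: (@height_inj _ _ z _ _ cop); apply/le_anti; rewrite h; exact: s_min.
rewrite (exchange_big_dep predT) //= mulr_natl -[X in _ *+ X]card_ord -sumr_const.
apply: eq_bigr => s _.
rewrite [RHS](reindex_inj (can_inj (@rot_compK n N s))) /=.
apply: eq_big => z; first by rewrite rot_comp_wcomp.
by case/andP=> zc _; rewrite f_rot.
Qed.

(** * Counting weak compositions, and moments of their parts *)

Lemma wcomp_le n N b (z : {ffun 'I_n.+1 -> 'I_N.+1}) i : z \in wcomp n N b -> (z i <= b)%N.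
Proof. by rewrite inE => /eqP <-; rewrite (bigD1 i) //= leq_addr. Qed.

(** Raising part i by 1 matches the compositions of b with those of b + 1 whose part i is positive;
    the others contribute [g 0 = 0]. *)
Lemma sum_wcomp_shift n N b (i : 'I_n.+1) (g : nat -> rat) :
  (b < N)%N -> g 0 = 0 ->
  \sum_(z in wcomp n N b.+1) g (z i) = \sum_(z in wcomp n N b) g (z i).+1.
Proof.
move=> bN g0.
pose upd (f : nat -> nat) (z : {ffun 'I_n.+1 -> 'I_N.+1}) :=
  [ffun j => if j == i then inord (f (z i)) else z j] : {ffun 'I_n.+1 -> 'I_N.+1}.
have updi f z : upd f z i = inord (f (z i)) by rewrite ffunE eqxx.
have sum_upd f z : (\sum_j upd f z j + z i = \sum_j z j + upd f z i)%N.
  have e : (\sum_(j | j != i) upd f z j = \sum_(j | j != i) z j)%N.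
    by apply: eq_bigr => j /negbTE ji; rewrite ffunE ji.
  rewrite (bigD1 i) //= e [in RHS](bigD1 i) //=.
  by rewrite [LHS]addnC -[RHS]addnA (addnC (upd f z i)).
rewrite (bigID (fun z : {ffun 'I_n.+1 -> 'I_N.+1} => 0 < z i)%N) /= addrC big1 ?add0r; last first.
  by move=> z /andP[_]; rewrite -eqn0Ngt => /eqP ->.
rewrite (reindex_onto (upd succn) (upd predn)) /=; last first.
  move=> z /andP[_ zi]; apply/ffunP => j; rewrite ffunE; case: eqP => [->|/eqP/negbTE ji].
    have hz : ((z i).-1 < N.+1)%N by have := ltn_ord (z i); lia.
    by rewrite updi (inordK hz) prednK // inord_val.
  by rewrite ffunE ji.
apply: eq_big => [z|z].
  have [lt_zN|] := ltnP (z i) N.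
    have zi : upd succn z i = (z i).+1 :> nat by rewrite updi inordK.
    have -> : upd predn (upd succn z) = z.
      apply/ffunP => j; rewrite ffunE; case: eqP => [->|/eqP/negbTE ji].
        by rewrite zi /= inord_val.
      by rewrite ffunE ji.
    rewrite eqxx andbT zi andbT !inE.
    have := sum_upd succn z; rewrite zi => e.
    by apply/eqP/eqP; lia.
  (* Here part i is N > b, so z does not have total b; and raising it overflows [inord], which
     returns its default 0. Both index conditions fail. *)
  move=> le_Nz.
  have -> : (z \in wcomp n N b) = false.
    by apply/negbTE/negP => /wcomp_le - /(_ i); lia.
  have -> : (0 < upd succn z i)%N = false; last by rewrite andbF.
  rewrite updi /inord /insubd insubF //; apply/negbTE; lia.
case/andP=> /andP[_ zi] _; rewrite updi inordK //.
by move: zi; rewrite updi /inord /insubd; case: insubP => //=.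
Qed.

Lemma sum_wcomp_perm n N b (s : {perm 'I_n.+1}) (f : {ffun 'I_n.+1 -> 'I_N.+1} -> rat) :
  \sum_(z in wcomp n N b) f [ffun i => z (s i)] = \sum_(z in wcomp n N b) f z.
Proof.
pose h (t : {perm 'I_n.+1}) (z : {ffun 'I_n.+1 -> 'I_N.+1}) := [ffun i => z (t i)].
have hK : cancel (h s) (h s^-1%g) by move=> z; apply/ffunP => i; rewrite !ffunE permKV.
rewrite [RHS](reindex_inj (can_inj hK)); apply: eq_bigl => z.
rewrite !inE; congr (_ == _); rewrite (reindex_inj (@perm_inj _ s)).
by apply: eq_bigr => i _; rewrite ffunE.
Qed.

(** By symmetry all parts have the same first moment, and the parts add up to b. *)
Lemma sum_wcomp1 n N b (i : 'I_n.+1) :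
  \sum_(z in wcomp n N b) (z i)%:R = b%:R / n.+1%:R * #|wcomp n N b|%:R :> rat.
Proof.
apply: (@mulfI _ n.+1%:R); first by rewrite pnatr_eq0.
rewrite mulrA mulrCA divff ?pnatr_eq0 // mulr1.
have -> : b%:R * #|wcomp n N b|%:R = \sum_(z in wcomp n N b) \sum_j (z j)%:R :> rat.
  rewrite (eq_bigr (fun=> b%:R)) ?sumr_const ?mulr_natr // => z.
  by rewrite inE -natr_sum => /eqP ->.
rewrite exchange_big /= [RHS](eq_bigr (fun=> \sum_(z in wcomp n N b) (z i)%:R)).
  by rewrite sumr_const card_ord mulr_natl.
move=> j _; rewrite -(sum_wcomp_perm _ (tperm i j)).
by apply: eq_bigr => z _; rewrite ffunE tpermR.
Qed.

Lemma card_wcompS n N b : (b < N)%N ->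
  b.+1%:R * #|wcomp n N b.+1|%:R = (b + n.+1)%:R * #|wcomp n N b|%:R :> rat.
Proof.
move=> bN; have := @sum_wcomp_shift n N b ord0 (fun t => t%:R) bN erefl.
rewrite sum_wcomp1 => e1.
have e2 : \sum_(z in wcomp n N b) (z ord0).+1%:R
    = b%:R / n.+1%:R * #|wcomp n N b|%:R + #|wcomp n N b|%:R :> rat.
  rewrite -(@sum_wcomp1 n N b ord0) -[X in _ = _ + X]mulr1 mulr_natl -sumr_const -big_split.
  by apply: eq_bigr => z _; rewrite -[_.+1]addn1 natrD.
(* Equate the first moments of totals b + 1 and b, both known by symmetry. *)
move: e1; rewrite e2 natrD => /(congr1 ( *%R n.+1%:R)).
have h : 1 + n%:R != 0 :> rat by rewrite nat1r pnatr_eq0.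
move=> e; have -> : b.+1%:R * #|wcomp n N b.+1|%:R
   = n.+1%:R * (b.+1%:R / n.+1%:R * #|wcomp n N b.+1|%:R) :> rat by field.
by rewrite e; field.
Qed.

Lemma wcomp0 n N : wcomp n N 0 = [set [ffun=> ord0]].
Proof.
apply/setP => z; rewrite !inE sum_nat_eq0; apply/forallP/eqP => [h|-> i].
  by apply/ffunP => i; rewrite ffunE; apply/val_inj/eqP/(h i).
by rewrite ffunE.
Qed.

(** Stars and bars; as b <= N, the bound on the parts excludes nothing. *)
Lemma card_wcomp n N b : (b <= N)%N -> #|wcomp n N b| = 'C(b + n, n).
Proof.
elim: b => [_|b IH bN]; first by rewrite wcomp0 cards1 add0n binn.
have /eqP := card_wcompS n bN; rewrite IH 1?ltnW // -!natrM eqr_nat => /eqP e.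
apply/eqP; rewrite -(eqn_pmul2l (ltn0Sn b)) e addnS -addSn.
by have := mul_bin_down (b.+1 + n) n; rewrite addnK => ->.
Qed.

(** Induction on b: the shift turns the square of a part at total b + 1 into the square of its
    successor at total b. *)
Lemma sum_wcomp2 n N b (i : 'I_n.+1) : (b <= N)%N ->
  \sum_(z in wcomp n N b) (z i)%:R ^+ 2
  = (b * (2 * b + n))%:R / (n.+1 * n.+2)%:R * #|wcomp n N b|%:R :> rat.
Proof.
elim: b => [_|b IH bN].
  by rewrite wcomp0 big_set1 ffunE mul0n !mul0r expr0n.
rewrite (sum_wcomp_shift i (g := fun t => t%:R ^+ 2) bN) ?expr0n //.
have -> : \sum_(z in wcomp n N b) (z i).+1%:R ^+ 2 = \sum_(z in wcomp n N b) (z i)%:R ^+ 2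
  + 2 * (\sum_(z in wcomp n N b) (z i)%:R) + #|wcomp n N b|%:R :> rat.
  rewrite mulr_sumr -[X in _ = _ + X]mulr1 mulr_natl -sumr_const -!big_split.
  by apply: eq_bigr => z _ /=; rewrite -natr1; ring.
rewrite IH 1?ltnW // sum_wcomp1.
have hb : b.+1%:R != 0 :> rat by rewrite pnatr_eq0.
have -> : #|wcomp n N b.+1|%:R = (b + n.+1)%:R * #|wcomp n N b|%:R / b.+1%:R :> rat.
  by rewrite -card_wcompS // mulrC mulKf.
rewrite ?(natrD, natrM); field.
by rewrite !nat1r -natrD !pnatr_eq0.
Qed.

(** Summing z_i z_l over all l gives b z_i, while symmetry makes the n terms with l != i equal in
    sum. Distinct indices ensure n != 0. *)
Lemma sum_wcomp11 n N b (i j : 'I_n.+1) : (b <= N)%N -> i != j ->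
  \sum_(z in wcomp n N b) (z i)%:R * (z j)%:R
  = (b * b.-1)%:R / (n.+1 * n.+2)%:R * #|wcomp n N b|%:R :> rat.
Proof.
move=> bN ij.
have n0 : n%:R != 0 :> rat.
  rewrite pnatr_eq0; apply: contra ij => /eqP n0; apply/eqP/val_inj => /=.
  by have := ltn_ord i; have := ltn_ord j; lia.
have e : \sum_(z in wcomp n N b) (z i)%:R ^+ 2
  + n%:R * (\sum_(z in wcomp n N b) (z i)%:R * (z j)%:R)
  = b%:R * \sum_(z in wcomp n N b) (z i)%:R :> rat.
  transitivity (\sum_l \sum_(z in wcomp n N b) (z i)%:R * (z l)%:R : rat); last first.
    rewrite exchange_big mulr_sumr; apply: eq_bigr => z.
    by rewrite inE -mulr_sumr -natr_sum mulrC => /eqP ->.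
  rewrite (bigD1 i) //=; congr (_ + _).
  rewrite [RHS](eq_bigr (fun=> \sum_(z in wcomp n N b) (z i)%:R * (z j)%:R)).
    by rewrite sumr_const mulr_natl; congr (_ *+ _); have := cardC1 i; rewrite card_ord.
  move=> l li; rewrite -(sum_wcomp_perm _ (tperm j l)).
  by apply: eq_bigr => z _; rewrite !ffunE tpermR tpermD // eq_sym.
have -> : (b * b.-1)%:R = b%:R * (b%:R - 1) :> rat.
  by case: b {bN e} => [|b]; rewrite ?mul0n ?mul0r // natrM /= -natr1 addrK.
move: e; rewrite sum_wcomp2 // sum_wcomp1; set B := \sum_(z in _) _ => e.
apply: (mulfI n0); move/(canRL (addKr _)): e => ->.
rewrite ?(natrD, natrM); field.
by rewrite !nat1r -natrD !pnatr_eq0.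
Qed.

(** * Moments of partial sums and of heights *)

Lemma sum_psum n N b d : (d <= n.+1)%N ->
  \sum_(z in wcomp n N b) (psum z d)%:R = (d * b)%:R / n.+1%:R * #|wcomp n N b|%:R :> rat.
Proof.
move=> dn; under eq_bigr do rewrite /psum natr_sum.
rewrite exchange_big /=; under eq_bigr do rewrite sum_wcomp1.
rewrite (big_ord_narrow dn) /= sumr_const card_ord -[LHS]mulr_natl natrM.
by rewrite !mulrA.
Qed.

Lemma sum_psum2 n N b d : (b <= N)%N -> (d <= n.+1)%N ->
  \sum_(z in wcomp n N b) (psum z d)%:R ^+ 2
  = (d * b * (d * b.-1 + b + n.+1))%:R / (n.+1 * n.+2)%:R * #|wcomp n N b|%:R :> rat.
Proof.
move=> bN dn; set M := #|_|%:R.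
(* [A] is the moment of a squared part and [B] that of a product of two distinct parts, so the
   diagonal of the expanded square is corrected by [A - B]. *)
pose A : rat := (b * (2 * b + n))%:R / (n.+1 * n.+2)%:R * M.
pose B : rat := (b * b.-1)%:R / (n.+1 * n.+2)%:R * M.
have -> : \sum_(z in wcomp n N b) (psum z d)%:R ^+ 2
  = \sum_(i < n.+1 | (i < d)%N) \sum_(j < n.+1 | (j < d)%N) (B + (A - B) *+ (i == j)).
  transitivity (\sum_(z in wcomp n N b) \sum_(i < n.+1 | (i < d)%N)
     \sum_(j < n.+1 | (j < d)%N) (z i)%:R * (z j)%:R : rat).
    apply: eq_bigr => z _; rewrite /psum natr_sum expr2 mulr_suml.
    by apply: eq_bigr => i _; rewrite mulr_sumr.
  rewrite exchange_big; apply: eq_bigr => i _; rewrite exchange_big; apply: eq_bigr => j _ /=.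
  have [<-|ij] := eqVneq i j; last by rewrite mulr0n addr0 sum_wcomp11.
  rewrite mulr1n addrC subrK; exact: (sum_wcomp2 i bN).
have -> : \sum_(i < n.+1 | (i < d)%N) \sum_(j < n.+1 | (j < d)%N) (B + (A - B) *+ (i == j))
  = \sum_(i < n.+1 | (i < d)%N) (B *+ d + (A - B)).
  apply: eq_bigr => i di; rewrite big_split /=; congr (_ + _).
    by rewrite (big_ord_narrow dn) /= sumr_const card_ord.
  rewrite (bigD1 i) //= eqxx mulr1n big1 ?addr0 // => j /andP[_ ji].
  by rewrite eq_sym (negbTE ji).
rewrite (big_ord_narrow dn) /= sumr_const card_ord /A /B.
have h1 : 1 + n%:R != 0 :> rat by rewrite nat1r pnatr_eq0.
have h2 : 2 + n%:R != 0 :> rat by rewrite -natrD pnatr_eq0.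
(* The case b = 0 is split off so that [b.-1] becomes a genuine subtraction. *)
case: b {bN M A B} (M) => [|b] M; first by rewrite !(mul0n, muln0, mul0r, mul0rn, addr0, subr0).
rewrite -pred_Sn -[LHS]mulr_natl -[_ *+ d]mulr_natl ?(natrD, natrM); field.
by rewrite h1 h2.
Qed.

(** Only the first two moments of the partial sums enter. The factor d (K - d) is that of a bridge
    pinned at 0 and K. *)
Lemma sum_height2 n N d : (d <= n.+1)%N ->
  \sum_(z in wcomp n N N) height z d ^+ 2
  = d%:R * (n.+1%:R - d%:R) * (N%:R * (n.+1 + N)%:R / n.+2%:R * #|wcomp n N N|%:R).
Proof.
move=> dn.
have -> : \sum_(z in wcomp n N N) height z d ^+ 2
  = (d * N)%:R ^+ 2 * #|wcomp n N N|%:R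
    - 2 * (d * N)%:R * n.+1%:R * (\sum_(z in wcomp n N N) (psum z d)%:R)
    + n.+1%:R ^+ 2 * \sum_(z in wcomp n N N) (psum z d)%:R ^+ 2.
  rewrite !mulr_sumr mulr_natr -sumr_const -sumrB -big_split.
  by apply: eq_bigr => z _ /=; rewrite /height (natrM _ n.+1); ring.
rewrite sum_psum // sum_psum2 //.
have h1 : 1 + n%:R != 0 :> rat by rewrite nat1r pnatr_eq0.
have h2 : 2 + n%:R != 0 :> rat by rewrite -natrD pnatr_eq0.
case: (N) => [|b]; first by rewrite !(mul0n, muln0, mul0r, mulr0, addr0, subr0, expr0n).
rewrite -pred_Sn ?(natrD, natrM); field.
by rewrite h1 h2.
Qed.

(** * The spread of the heights and its total *)

(* 2 K^2 times the variance of the K = n + 1 heights. *)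
Definition spread n N (z : {ffun 'I_n.+1 -> 'I_N.+1}) : rat :=
  \sum_(i < n.+1) \sum_(j < n.+1) (height z i - height z j) ^+ 2.

(** Rotation permutes the heights and shifts them all by one constant, which cancels in
    differences. *)
Lemma spread_rot n N s (z : {ffun 'I_n.+1 -> 'I_N.+1}) :
  z \in wcomp n N N -> spread (rot_comp s z) = spread z.
Proof.
move=> zc; rewrite [RHS](reindex_inj (addIr s)); apply: eq_bigr => i _.
rewrite [RHS](reindex_inj (addIr s)); apply: eq_bigr => j _.
by rewrite !height_rot //=; ring.
Qed.

Lemma sum_ord n : \sum_(i < n.+1) (i : nat)%:R = n%:R * n.+1%:R / 2 :> rat.
Proof.
elim: n => [|n IH]; first by rewrite big_ord1 !mul0r.
by rewrite big_ord_recr IH /=; field.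
Qed.

Lemma sum_ord_sqr n :
  \sum_(i < n.+1) (i : nat)%:R ^+ 2 = n%:R * n.+1%:R * (2 * n%:R + 1) / 6 :> rat.
Proof.
elim: n => [|n IH]; first by rewrite big_ord1 !mul0r expr0n.
by rewrite big_ord_recr IH /=; field.
Qed.

Lemma sum_spread n N :
  \sum_(z in wcomp n N N) spread z
  = n.+1%:R ^+ 2 * n%:R * N%:R * (n.+1 + N)%:R / 6 * #|wcomp n N N|%:R.
Proof.
have -> : \sum_(z in wcomp n N N) spread z
  = \sum_(s < n.+1) \sum_(d < n.+1) \sum_(z in wcomp n N N) height z d ^+ 2.
  (* The difference of the heights at d + s and s is the height at d of the rotation by s. Rotations
     permute the compositions, so s then drops out. *)
  transitivity (\sum_(z in wcomp n N N) \sum_(s < n.+1) \sum_(d < n.+1)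
     height (rot_comp s z) d ^+ 2).
    apply: eq_bigr => z zc; rewrite /spread exchange_big; apply: eq_bigr => s _.
    by rewrite (reindex_inj (addIr s)); apply: eq_bigr => d _; rewrite height_rot.
  rewrite exchange_big; apply: eq_bigr => s _; rewrite exchange_big; apply: eq_bigr => d _.
  rewrite [RHS](reindex_inj (can_inj (@rot_compK n N s))).
  by apply: eq_bigl => z; rewrite rot_comp_wcomp.
under eq_bigr do under eq_bigr do rewrite sum_height2 1?ltnW //.
rewrite sumr_const card_ord -mulr_suml.
have -> : \sum_(d < n.+1) d%:R * (n.+1%:R - d%:R)
  = n.+1%:R * (\sum_(d < n.+1) (d : nat)%:R) - \sum_(d < n.+1) (d : nat)%:R ^+ 2 :> rat.
  by rewrite mulr_sumr -sumrB; apply: eq_bigr => d _; ring.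
rewrite sum_ord sum_ord_sqr -[LHS]mulr_natl natrD.
have h2 : 2 + n%:R != 0 :> rat by rewrite -natrD pnatr_eq0.
by field.
Qed.

Lemma sum_dyck n N : coprime n.+1 N ->
  \sum_(z in wcomp n N N | dyck z)
     (spread z / (4 * n.+1%:R ^+ 2) - (n.+1%:R ^+ 2 - 1) / 24)
  = n%:R * (N%:R - 1) * (N%:R + n%:R + 2) / (24 * n.+1%:R) * 'C(N + n, n)%:R.
Proof.
move=> cop.
have h1 : 1 + n%:R != 0 :> rat by rewrite nat1r pnatr_eq0.
apply: (@mulfI _ n.+1%:R); first by rewrite pnatr_eq0.
rewrite -cycle_lemma => [|//|s z zc]; last by rewrite spread_rot.
rewrite sumrB -mulr_suml sum_spread sumr_const card_wcomp // -[X in _ - X]mulr_natl natrD.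
by field.
Qed.

(** * The size statistic in terms of runner lengths *)

Lemma bin2_rat n : 'C(n, 2)%:R = n%:R * (n%:R - 1) / 2 :> rat.
Proof.
elim: n => [|n IH]; first by rewrite !mul0r.
by rewrite binS bin1 natrD IH; field.
Qed.

(** With f_r = r + K c_r, the squares f_r^2 carry the sums along the runners, and the squared total
    of f carries the binomial coefficient. The subtracted constant is the value of the first term
    when all c_r vanish. *)
Lemma size_of_runners n (c : 'I_n.+1 -> nat) :
  (\sum_(r < n.+1) \sum_(j < c r) (r + n.+1 * j))%N%:R - 'C(\sum_(r < n.+1) c r, 2)%:R
  = (\sum_(i < n.+1) \sum_(j < n.+1)
        ((i + n.+1 * c i)%:R - (j + n.+1 * c j)%:R) ^+ 2) / (4 * n.+1%:R ^+ 2)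
    - (n.+1%:R ^+ 2 - 1) / 24 :> rat.
Proof.
have h1 : 1 + n%:R != 0 :> rat by rewrite nat1r pnatr_eq0.
pose f (i : 'I_n.+1) : rat := (i + n.+1 * c i)%:R.
have -> : \sum_(i < n.+1) \sum_(j < n.+1) ((i + n.+1 * c i)%:R - (j + n.+1 * c j)%:R) ^+ 2
  = 2 * n.+1%:R * (\sum_i f i ^+ 2) - 2 * (\sum_i f i) ^+ 2 :> rat.
  transitivity (\sum_(i < n.+1) (n.+1%:R * f i ^+ 2 - 2 * f i * (\sum_j f j) + \sum_j f j ^+ 2)).
    apply: eq_bigr => i _.
    have -> : n.+1%:R * f i ^+ 2 = \sum_(j < n.+1) f i ^+ 2.
      by rewrite sumr_const card_ord mulr_natl.
    rewrite mulr_sumr -sumrB -big_split.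
    by apply: eq_bigr => j _ /=; rewrite -/(f i) -/(f j); ring.
  rewrite big_split sumrB /= -mulr_suml -!mulr_sumr sumr_const card_ord -[X in _ + X]mulr_natl.
  ring.
have -> : \sum_i f i ^+ 2 = \sum_(i < n.+1) (i : nat)%:R ^+ 2
  + 2 * n.+1%:R * (\sum_(i < n.+1) (i : nat)%:R * (c i)%:R)
  + n.+1%:R ^+ 2 * (\sum_(i < n.+1) (c i)%:R ^+ 2).
  rewrite !mulr_sumr -!big_split; apply: eq_bigr => i _ /=.
  by rewrite /f natrD natrM; ring.
have -> : \sum_i f i = \sum_(i < n.+1) (i : nat)%:R + n.+1%:R * (\sum_(i < n.+1) (c i)%:R).
  by rewrite mulr_sumr -!big_split; apply: eq_bigr => i _ /=; rewrite /f natrD natrM.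
have -> : (\sum_(r < n.+1) \sum_(j < c r) (r + n.+1 * j))%N%:R
  = \sum_(i < n.+1) (i : nat)%:R * (c i)%:R
  + n.+1%:R / 2 * (\sum_(i < n.+1) (c i)%:R ^+ 2 - \sum_(i < n.+1) (c i)%:R) :> rat.
  rewrite natr_sum -sumrB mulr_sumr -big_split; apply: eq_bigr => r _ /=.
  rewrite big_split sum_nat_const card_ord -big_distrr /= -(big_mkord xpredT id) bin2_sum.
  by rewrite natrD !natrM bin2_rat; field.
rewrite bin2_rat natr_sum sum_ord sum_ord_sqr.
set X := \sum_(i < n.+1) _ * _; set Y := \sum_(i < n.+1) _ ^+ 2; set Z := \sum_(i < n.+1) _.
by field.
Qed.

(** * From Dyck compositions to order ideals *)

Lemma gap_val_inj a b : injective (@gap_val a b).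
Proof. by move=> x y /val_inj /val_inj. Qed.

(** For N = m K + 1 this solves h_r = r + K c_r for c_r; the subtraction may truncate when z is not
    Dyck. *)
Definition runner m n N (z : {ffun 'I_n.+1 -> 'I_N.+1}) (r : nat) : nat :=
  (r * m - psum z r)%N.

Definition ideal_of m n (z : {ffun 'I_n.+1 -> 'I_(m * n.+1 + 1).+1}) :
  {set gap_poset n.+1 (m * n.+1 + 1)} :=
  [set x | (gap_val x %/ n.+1 < runner m z (gap_val x %% n.+1))%N].

(** K times the partial sum is at most r N = K r m + r, and r < K removes the remainder on division
    by K. *)
Lemma dyck_psum m n (z : {ffun 'I_n.+1 -> 'I_(m * n.+1 + 1).+1}) (r : 'I_n.+1) :
  dyck z -> (psum z r <= r * m)%N.
Proof.
move/forallP/(_ r); rewrite /height subr_ge0 ler_nat => h.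
have {h} : (n.+1 * psum z r < n.+1 * (r * m).+1)%N by have := ltn_ord r; nia.
by rewrite ltn_pmul2l.
Qed.

Lemma psum_dyck m n (z : {ffun 'I_n.+1 -> 'I_(m * n.+1 + 1).+1}) :
  (forall r : 'I_n.+1, psum z r <= r * m)%N -> dyck z.
Proof.
move=> h; apply/forallP => r; rewrite /height subr_ge0 ler_nat.
by have := h r; nia.
Qed.

Lemma height_runner m n (z : {ffun 'I_n.+1 -> 'I_(m * n.+1 + 1).+1}) (r : 'I_n.+1) :
  dyck z -> height z r = (r + n.+1 * runner m z r)%:R.
Proof.
move=> /(@dyck_psum _ _ _ r) h; apply/eqP; rewrite /height subr_eq -natrD eqr_nat; apply/eqP.
by rewrite /runner mulnBr -addnA subnK ?leq_pmul2l //; lia.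
Qed.

(** In a representation u K + v N the residue forces v = r mod K, so v >= r and the value is at
    least r N = r + K r m, which is too large. *)
Lemma gap_runner m n (r j : nat) : (r < n.+1)%N -> (j < r * m)%N ->
  gap n.+1 (m * n.+1 + 1) (r + n.+1 * j).
Proof.
move=> rn jr; apply/andP; split; first by case: r rn jr.
apply/negP => /in_semigroupP; rewrite addn1 => /(_ isT isT) [u [v e]].
have vr : (v %% n.+1 = r)%N.
  move/(congr1 (modn^~ n.+1)): e; rewrite addnC mulnC modnMDl modn_small // => ->.
  have -> : (u * n.+1 + v * (m * n.+1).+1 = (u + v * m) * n.+1 + v)%N by lia.
  by rewrite modnMDl.
have rv : (r <= v)%N by rewrite -vr leq_mod.
have := leq_mul rv (leqnn (m * n.+1).+1); have := leq_mul (leqnn n.+1) jr; lia.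
Qed.

(** Even when z is not Dyck, a runner has length at most r m, so [gap_runner] realises each of its
    places by an element of the poset. *)
Lemma mem_ideal_of m n (z : {ffun 'I_n.+1 -> 'I_(m * n.+1 + 1).+1}) (r : 'I_n.+1) j :
  (j < runner m z r)%N <-> exists2 x, x \in ideal_of z & gap_val x = (r + n.+1 * j)%N.
Proof.
have divr : ((r + n.+1 * j) %/ n.+1 = j)%N by rewrite addnC mulnC divnMDl // divn_small ?addn0.
have modr : ((r + n.+1 * j) %% n.+1 = r)%N by rewrite addnC mulnC modnMDl modn_small.
split=> [jr|[x xz e]]; last by move: xz; rewrite inE e divr modr.
have cop : coprime n.+1 (m * n.+1 + 1) by rewrite /coprime gcdnMDl gcdn1.
have N0 : (0 < m * n.+1 + 1)%N by rewrite addn1.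
have gj : gap n.+1 (m * n.+1 + 1) (r + n.+1 * j).
  by apply: gap_runner => //; apply: leq_trans jr (leq_subr _ _).
have [x xE] := (gap_posetP _ (ltn0Sn n) N0 cop).1 gj.
exists x => //; rewrite inE xE divr modr //.
Qed.

Lemma sum_ideal_of m n (z : {ffun 'I_n.+1 -> 'I_(m * n.+1 + 1).+1}) (g : nat -> nat) :
  (\sum_(x in ideal_of z) g (gap_val x)
   = \sum_(r < n.+1) \sum_(j < runner m z r) g (r + n.+1 * j))%N.
Proof.
set N := (m * n.+1 + 1)%N.
have cN (r : 'I_n.+1) : (runner m z r <= N)%N.
  by rewrite /runner /N; have := ltn_ord r; nia.
have -> : (\sum_(r < n.+1) \sum_(j < runner m z r) g (r + n.+1 * j)
  = \sum_(p : 'I_n.+1 * 'I_N | p.2 < runner m z p.1) g (p.1 + n.+1 * p.2))%N.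
  rewrite -(pair_big_dep xpredT (fun (r : 'I_n.+1) (j : 'I_N) => j < runner m z r)%N
     (fun r j => g (r + n.+1 * j)%N)) /=.
  apply: eq_bigr => r _.
  by rewrite (big_ord_narrow (cN r)).
have ltN (x : gap_poset n.+1 N) : (gap_val x %/ n.+1 < N)%N by rewrite ltn_divLR // mulnC ltn_ord.
pose h (x : gap_poset n.+1 N) : 'I_n.+1 * 'I_N :=
  (Ordinal (ltn_pmod (gap_val x) (ltn0Sn n)), Ordinal (ltN x)).
have hE x : ((h x).1 + n.+1 * (h x).2 = gap_val x)%N by rewrite /= addnC mulnC -divn_eq.
(* A pair of residue and quotient need not come from a gap, so the inverse of [h] is partial;
   [mem_ideal_of] shows it is defined within the runners. *)
pose h' (p : 'I_n.+1 * 'I_N) := [pick x : gap_poset n.+1 N | gap_val x == (p.1 + n.+1 * p.2)%N].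
rewrite [RHS](reindex_omap h h') => [|p /mem_ideal_of [x _ xE]].
  apply: eq_big => [x|x _]; last by rewrite hE.
  rewrite inE /=; have -> : h' (h x) = Some x.
    rewrite /h' hE; case: pickP => [y /eqP /gap_val_inj -> //|/(_ x)].
    by rewrite eqxx.
  by rewrite eqxx andbT.
rewrite /h'; case: pickP => [y /eqP yE|/(_ x)]; last by rewrite xE eqxx.
congr Some; apply/eqP; rewrite -pair_eqE; apply/andP; split; apply/eqP/val_inj; rewrite /= yE.
  by rewrite addnC mulnC modnMDl modn_small.
by rewrite addnC mulnC divnMDl // divn_small ?addn0.
Qed.

Lemma size_ideal_of m n (z : {ffun 'I_n.+1 -> 'I_(m * n.+1 + 1).+1}) :
  dyck z ->
  (sigma (ideal_of z))%:R - 'C(#|ideal_of z|, 2)%:R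
  = spread z / (4 * n.+1%:R ^+ 2) - (n.+1%:R ^+ 2 - 1) / 24.
Proof.
move=> dz; have -> : #|ideal_of z| = (\sum_(r < n.+1) runner m z r)%N.
  rewrite -sum1_card (sum_ideal_of z (fun=> 1%N)).
  by apply: eq_bigr => r _; rewrite sum_nat_const card_ord muln1.
rewrite /sigma (sum_ideal_of z id) size_of_runners; congr (_ / _ - _).
by apply: eq_bigr => i _; apply: eq_bigr => j _; rewrite !height_runner.
Qed.

(** Partial sums do not decrease. This encodes closure under subtracting N, which passes from
    residue r + 1 to residue r and m places down. *)
Lemma runner_step m n (z : {ffun 'I_n.+1 -> 'I_(m * n.+1 + 1).+1}) (r : nat) :
  (r < n)%N -> (runner m z r.+1 <= runner m z r + m)%N.
Proof.
by move=> rn; have := psumS z (Ordinal (leqW rn)); rewrite /runner /= mulSn => ->; lia.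
Qed.

Lemma ideal_of_ideal m n (z : {ffun 'I_n.+1 -> 'I_(m * n.+1 + 1).+1}) :
  ideal_of z \in order_ideals (gap_poset n.+1 (m * n.+1 + 1)).
Proof.
rewrite inE; apply/'forall_implyP => x xz; apply/forallP => y; apply/implyP.
case/connectP => s; elim: s y => [|y1 s IH] y /=; first by move=> _ <-.
case/andP => cov /IH{}IH /IH; rewrite !inE.
set v := gap_val y; have vE := divn_eq v n.+1.
have rn : (v %% n.+1 < n.+1)%N by rewrite ltn_pmod.
case/orP: cov => /eqP ->; rewrite -/v.
  by rewrite divnDr ?modnDr //; apply: leq_ltn_trans; rewrite leq_addr.
have -> : (v + (m * n.+1 + 1) = (v %/ n.+1 + m) * n.+1 + (v %% n.+1).+1)%N by lia.
have [rn'|rn'] := ltnP (v %% n.+1) n.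
  rewrite divnMDl // modnMDl (@modn_small _.+1) // (@divn_small _.+1) // addn0 => h.
  by have := runner_step z rn'; lia.
(* From residue n, adding N leads to residue 0, whose runner is empty, so the upper element cannot
   lie in the ideal. *)
have -> : ((v %% n.+1).+1 = n.+1)%N by lia.
by rewrite modnMDl modnn /runner mul0n.
Qed.

(** * Bijectivity of the correspondence *)

(** The ideal determines the runner lengths. For Dyck compositions these give back the partial sums
    without truncation, the last one being the fixed total. *)
Lemma ideal_of_inj m n : {in [set z in wcomp n (m * n.+1 + 1) (m * n.+1 + 1) | dyck z] &,
  injective (@ideal_of m n)}.
Proof.
move=> z z'; rewrite !inE -!/(_ \in wcomp _ _ _) => /andP[/eqP zc dz] /andP[/eqP zc' dz'] e.
have runE (r : 'I_n.+1) : runner m z r = runner m z' r.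
  have lt_iff j : (j < runner m z r)%N = (j < runner m z' r)%N.
    by apply/idP/idP => /mem_ideal_of h; apply/mem_ideal_of; [rewrite -e | rewrite e].
  have := lt_iff (runner m z r); have := lt_iff (runner m z' r); rewrite !ltnn; lia.
have psumE r : (r <= n.+1)%N -> psum z r = psum z' r.
  rewrite leq_eqVlt => /orP[/eqP ->|rn].
    by rewrite !(@psum_full _ _ (m * n.+1 + 1)) // inE ?zc ?zc'.
  have := runE (Ordinal rn); rewrite /runner /=.
  by have := dyck_psum (Ordinal rn) dz; have := dyck_psum (Ordinal rn) dz'; rewrite /=; lia.
apply/ffunP => r; apply: val_inj => /=.
have := psumS z r; have := psumS z' r; have := ltn_ord r.
by move=> rn; rewrite (psumE r.+1) // (psumE r) 1?ltnW //; lia.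
Qed.

(** Such a predicate is an initial segment, whose length is its count; this reads runner lengths off
    an ideal. *)
Lemma count_downclosed (p : pred nat) N :
  (forall j, p j.+1 -> p j) -> (forall j, p j -> (j < N)%N) ->
  forall j, (j < \sum_(i < N) p i)%N = p j.
Proof.
move=> dn; have down i j : (i <= j)%N -> p j -> p i.
  by move/subnKC <-; elim: (j - i)%N => [|d IH]; rewrite ?addn0 ?addnS // => /dn.
have sum_le M : (\sum_(i < M) p i <= M)%N.
  by rewrite -[leqRHS]card_ord -sum1_card leq_sum // => i _; case: (p i).
suff H M j : (j < M)%N -> (j < \sum_(i < M) p i)%N = p j.
  move=> bnd j; have [/H //|Nj] := ltnP j N; apply/idP/idP => [h|/bnd]; last by lia.
  by have := sum_le N; lia.
elim: M j => // M IH j; rewrite big_ord_recr /= ltnS => jM.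
case pM: (p M) => /=.
  rewrite (eq_bigr (fun=> 1%N)) => [|i _]; last by rewrite (down i M) // ltnW.
  by rewrite sum_nat_const card_ord muln1 addn1 ltnS jM (down j M).
rewrite addn0; move: jM; rewrite leq_eqVlt => /orP[/eqP ->|]; last exact: IH.
by rewrite pM ltnNge sum_le.
Qed.

Lemma ideal_of_surj m n (I : {set gap_poset n.+1 (m * n.+1 + 1)}) :
  I \in order_ideals (gap_poset n.+1 (m * n.+1 + 1)) ->
  exists2 z, z \in [set z in wcomp n (m * n.+1 + 1) (m * n.+1 + 1) | dyck z]
    & I = ideal_of z.
Proof.
set N := (m * n.+1 + 1)%N; rewrite inE => /'forall_implyP I_down.
have N0 : (0 < N)%N by rewrite /N addn1.
have cop : coprime n.+1 N by rewrite /coprime gcdnMDl gcdn1.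
pose p y := [exists x in I, gap_val x == y].
have p_gap y : p y -> gap n.+1 N y.
  case/existsP => x /andP[_ /eqP <-]; exact: (valP x).
(* The point is that y is again a gap: otherwise adding the generator d would put y + d in the
   semigroup. *)
have p_down y d : (d == n.+1) || (d == N) -> p (y + d)%N -> p y.
  move=> dE pyd; have := p_gap _ pyd; case/andP => _ ngap.
  have gy : gap n.+1 N y.
    apply/andP; split.
      rewrite lt0n; apply: contra ngap => /eqP ->.
      apply/in_semigroupP => //.
      by case/orP: dE => /eqP ->; [exists 1%N, 0%N | exists 0%N, 1%N]; lia.
    apply: contra ngap => /in_semigroupP -/(_ isT N0) [u [v e]].
    apply/in_semigroupP => //.
    by case/orP: dE => /eqP ->; [exists u.+1, v | exists u, v.+1]; lia.
  have [y' y'E] := (gap_posetP y (ltn0Sn n) N0 cop).1 gy.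
  case/existsP: pyd => x /andP[xI /eqP xE].
  apply/existsP; exists y'; rewrite y'E eqxx andbT.
  have /forallP/(_ y')/implyP := I_down _ xI; apply; apply: connect1.
  by rewrite /gap_cover y'E xE !eqn_add2l.
(* The value 0 at r = K stands for the empty runner 0 and closes the cycle. *)
pose c r := if (r < n.+1)%N then (\sum_(j < N) p (r + n.+1 * j))%N else 0%N.
have cE r j : (r < n.+1)%N -> (j < c r)%N = p (r + n.+1 * j)%N.
  move=> rn; rewrite /c rn.
  apply: (@count_downclosed (fun j => p (r + n.+1 * j)%N)) => {}j.
    by rewrite mulnS addnCA addnC; apply: p_down; rewrite eqxx.
  move/p_gap/(gap_ltn (ltn0Sn n) N0 cop) => h.
  by rewrite -(ltn_pmul2l (ltn0Sn n)); apply: leq_ltn_trans h; rewrite leq_addl.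
(* A nonempty runner 0 would contain 0, which is not a gap. *)
have c0 : c 0 = 0%N.
  apply/eqP; rewrite -leqn0 leqNgt cE //; apply/negP => /p_gap.
  by rewrite muln0.
have c_step r : (r < n)%N -> (c r.+1 <= c r + m)%N.
  (* Otherwise the ideal contains the number lying N above the first missing place of runner r,
     hence that place too. *)
  move=> rn; rewrite leqNgt cE //; apply/negP.
  have -> : (r.+1 + n.+1 * (c r + m) = (r + n.+1 * c r) + N)%N by rewrite /N; lia.
  by move/(p_down _ _ _); rewrite eqxx orbT -cE ?ltnn 1?ltnW // => /(_ isT).
have c_end : c n.+1 = 0%N by rewrite /c ltnn.
have c_le r : (r < n.+1)%N -> (c r <= r * m)%N.
  elim: r => [|r IH] rn; first by rewrite c0.
  by apply: leq_trans (c_step _ rn) _; rewrite mulSn addnC leq_add2l IH // ltnW.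
(* These differences telescope to the partial sums r m - c_r; the extra 1 at r = n raises the total
   to m K + 1 = N. *)
pose w r := (c r + m + (r == n) - c r.+1)%N.
have wN (r : 'I_n.+1) : (w r < N.+1)%N.
  have := c_le r (ltn_ord r); have := ltn_ord r; rewrite /w /N; nia.
pose z : {ffun 'I_n.+1 -> 'I_N.+1} := [ffun r => Ordinal (wN r)].
have psumE r : (r < n.+1)%N -> (psum z r + c r = r * m)%N.
  elim: r => [|r IH] rn; first by rewrite psum0 c0.
  have := psumS z (Ordinal (ltnW rn)); rewrite /= ffunE /= => ->.
  have := IH (ltnW rn); have := c_step _ rn; rewrite /w ltn_eqF // mulSn; lia.
have zc : z \in wcomp n N N.
  rewrite inE; apply/eqP; have <- : psum z n.+1 = (\sum_i z i)%N.
    by apply: eq_bigl => j; exact: ltn_ord.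
  have := psumS z ord_max; rewrite /= ffunE /= => ->.
  by have := psumE n (ltnSn n); rewrite /w c_end eqxx /N; lia.
have runE r : (r < n.+1)%N -> runner m z r = c r.
  by move=> /psumE; rewrite /runner; lia.
exists z.
  rewrite inE zc; apply: psum_dyck => r.
  by rewrite -(psumE r (ltn_ord r)) leq_addr.
apply/setP => x; rewrite inE runE ?ltn_pmod // cE ?ltn_pmod //.
rewrite addnC mulnC -divn_eq; apply/idP/existsP => [xI|[y /andP[yI /eqP /gap_val_inj <- //]]].
by exists x; rewrite xI /=.
Qed.

Theorem theorem1p3 (m k : nat) (hm : (1 <= m)%N) (hk : (1 <= k)%N) :
  \sum_(I in order_ideals (gap_poset k (m * k + 1)))
      ((sigma I)%:R - 'C(#|I|, 2)%:R : rat)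
  = (m%:R * k%:R * (k%:R - 1) * ((m%:R + 1) * k%:R + 2))
      / (24 * (m%:R * k%:R + 1)) * 'C((m + 1) * k, k)%:R.
Proof.
case: k hk => // n _; set N := (m * n.+1 + 1)%N.
have idealsE : order_ideals (gap_poset n.+1 N)
    = @ideal_of m n @: [set z in wcomp n N N | dyck z].
  apply/setP => I; apply/idP/imsetP => [/ideal_of_surj //|[z _ ->]].
  exact: ideal_of_ideal.
rewrite idealsE big_imset /=; last exact: ideal_of_inj.
under eq_bigl do rewrite inE.
rewrite (eq_bigr (fun z => spread z / (4 * n.+1%:R ^+ 2) - (n.+1%:R ^+ 2 - 1) / 24)); last first.
  by move=> z /andP[_]; exact: size_ideal_of.
rewrite sum_dyck -/N; last by rewrite /coprime gcdnMDl gcdn1.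
(* Absorption identity for binomials, using (m + 1) K = N + n. *)
have binE : n.+1%:R * 'C((m + 1) * n.+1, n.+1)%:R = N%:R * 'C(N + n, n)%:R :> rat.
  rewrite -!natrM mul_bin_left; congr (_ * _)%:R; first by rewrite /N; lia.
  by congr 'C(_, _); rewrite /N; lia.
have k0 : 1 + n%:R != 0 :> rat by rewrite nat1r pnatr_eq0.
have NE : m%:R * n.+1%:R + 1 = N%:R :> rat by rewrite natrD natrM.
have N0 : N%:R != 0 :> rat by rewrite pnatr_eq0 /N addn1.
have -> : 'C((m + 1) * n.+1, n.+1)%:R = N%:R * 'C(N + n, n)%:R / n.+1%:R :> rat.
  by rewrite -binE mulrC mulKf // pnatr_eq0.
rewrite NE.
have -> : m%:R * n.+1%:R = N%:R - 1 :> rat by rewrite -NE addrK.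
have -> : (m%:R + 1) * n.+1%:R + 2 = N%:R + n%:R + 2 :> rat.
  by rewrite -NE; ring.
by clear idealsE; clearbody N; field; rewrite ?N0 ?k0.
Qed.
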